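(* Let $\mathbb{G}=\mathbb{K}\ltimes\mathbb{H}$, where $\mathbb{H}$ is a locally compact abelian group and $\mathbb{K}$ is a finite abelian group acting on $\mathbb{H}$ via $\phi:\mathbb{K}\to\operatorname{Aut}(\mathbb{H})$. Let $F\subset\widehat{\mathcal{S}}$ and $E\subset\mathbb{H}/\mathbb{K}$ be finite sets, and let $\sigma:\mathbb{H}/\mathbb{K}\to\mathbb{H}$ be a section. With the notation of the context, the evaluation operator $\mathrm{ev}:\mathbb{C}^{\mathbb{K}}\otimes\mathbb{C}^{\mathbb{K}}\otimes\mathbb{C}^F\to\mathbb{C}^{\mathbb{K}}\otimes\mathbb{C}^{\mathbb{K}}\otimes\mathbb{C}^E$ decomposes as $$\mathrm{ev}=(\mathrm{id}\otimes\mathcal{F}^*\otimes\mathrm{id})\circ\mathcal{P}_{\mathbb{C}^E}^{-1}\circ\mathcal{J}^E\circ\mathcal{P}_{\mathbb{C}^F}\circ(\mathrm{id}\otimes\mathcal{F}\otimes\mathrm{id}).$$ In particular, the AP interpolation problem on $(E,F)$ is well-posed if and only if $\mathcal{J}^E$ is invertible.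
   Context: $\mathbb{K}$ is written multiplicatively and has cardinality $N$; $\mathbb{H}$ is written additively; $\phi$ acts by topological automorphisms; the group law of $\mathbb{G}$ is $(k,x)(h,y)=(kh,x+\phi(k)y)$. $\mathbb{H}/\mathbb{K}$ is the set of $\mathbb{K}$-orbits in $\mathbb{H}$. $\widehat{\mathbb{H}}$ and $\widehat{\mathbb{K}}$ are the Pontryagin duals. $\mathbb{K}$ acts on $\widehat{\mathbb{H}}$ by $\phi(k)\lambda(x):=\lambda(\phi(k^{-1})x)$. $\widehat{\mathcal{S}}\subset\widehat{\mathbb{H}}$ is a fixed set containing exactly one representative of each $\mathbb{K}$-orbit in $\widehat{\mathbb{H}}$ having trivial stabilizer. For $\lambda\in\widehat{\mathcal{S}}$, $T^\lambda$ is the representation of $\mathbb{G}$ on $\mathbb{C}^{\mathbb{K}}$ given by $(T^\lambda(k,x)v)(h)=\phi(h)\lambda(x)\,v(k^{-1}h)$. Let $\{\delta_n\}_{n\in\mathbb{K}}$ be the canonical basis of $\mathbb{C}^{\mathbb{K}}$. $\mathrm{AP}_F(\mathbb{G})$ is the space of functions $f:\mathbb{G}\to\mathbb{C}$ of the form $f(g)=\sum_{\lambda\in F}\sum_{n,m\in\mathbb{K}}\langle T^\lambda(g)\delta_n,\delta_m\rangle a_{n,m}(\lambda)$ with $a_{n,m}:F\to\mathbb{C}$. The map $\mathcal{F}_{\mathrm{AP}}:\mathrm{AP}_F(\mathbb{G})\to\mathbb{C}^{\mathbb{K}}\otimes\mathbb{C}^{\mathbb{K}}\otimes\mathbb{C}^F$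 is the linear bijection $f\mapsto\hat f$ whose inverse sends $\hat f$ to $f(k,x)=\sum_{\lambda\in F}\sum_{n\in\mathbb{K}}\phi(nk)\lambda(x)\hat f(k,n,\lambda)$. A section is any map $\sigma:\mathbb{H}/\mathbb{K}\to\mathbb{H}$ (no regularity assumed) with $\sigma(y)$ belonging to the orbit $y$. The set $E$ determines the sampling set $\tilde E=\{(k,\phi(h)\sigma(y)): k,h\in\mathbb{K},\,y\in E\}\subset\mathbb{G}$. The sampling operator $\mathrm{sampl}:\mathbb{C}^{\mathbb{G}}\to\mathbb{C}^{\mathbb{K}}\otimes\mathbb{C}^{\mathbb{K}}\otimes\mathbb{C}^E$ is $\mathrm{sampl}\,\psi(k,h,y)=\psi(k,\phi(h)\sigma(y))$, and $\mathrm{ev}=\mathrm{sampl}\circ\mathcal{F}_{\mathrm{AP}}^{-1}$. An AP interpolation of $\Psi:\mathbb{G}\to\mathbb{C}$ on $(E,F)$ is a function $f\in\mathrm{AP}_F(\mathbb{G})$ with $\mathrm{ev}\,\hat f=\mathrm{sampl}\,\Psi$. The AP interpolation problem on $(E,F)$ is well-posed if every $\Psi:\mathbb{G}\to\mathbb{C}$ has exactly one AP interpolation $f\in\mathrm{AP}_F(\mathbb{G})$. For $\hat n\in\widehat{\mathbb{K}}$, $\lambda\in\widehat{\mathcal{S}}$, $y\in\mathbb{H}/\mathbb{K}$, the generalized Bessel function is $J_{\hat n}(\lambda,y)=\sum_{r\in\mathbb{K}}\lambda(\phi(r)\sigma(y))\overline{\hat n(r)}$. The discrete Fourier-Bessel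 operator on $(E,F)$ is $\mathcal{J}^E:\bigoplus_{k\in\mathbb{K},\hat n\in\widehat{\mathbb{K}}}\mathbb{C}^F\to\bigoplus_{k\in\mathbb{K},\hat n\in\widehat{\mathbb{K}}}\mathbb{C}^E$ given by $(\mathcal{J}^Eu)_{k,\hat n}(y)=\overline{\hat n(k)}\sum_{\lambda\in F}J_{\hat n}(\lambda,y)u_{k,\hat n}(\lambda)$ for $y\in E$. $\mathcal{F}:\mathbb{C}^{\mathbb{K}}\to\mathbb{C}^{\widehat{\mathbb{K}}}$ is $\mathcal{F}v(\hat k)=\frac1{\sqrt N}\sum_{h\in\mathbb{K}}\overline{\hat k(h)}v(h)$, and $\mathcal{F}^*$ is its adjoint. For a vector space $V$, $\mathcal{P}_V:\mathbb{C}^{\mathbb{K}}\otimes\mathbb{C}^{\widehat{\mathbb{K}}}\otimes V\to\bigoplus_{k\in\mathbb{K},\hat n\in\widehat{\mathbb{K}}}V$ is the bijection $\mathcal{P}_V(a\otimes b\otimes v)=(a_kb_{\hat n}v)_{k,\hat n}$. *)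

(* Defs.v *)
From HB Require Import structures.
From mathcomp Require Import all_boot all_order all_algebra all_fingroup.
From mathcomp Require Import cyclic.
From mathcomp Require Import finmap complex.
From mathcomp Require Import all_classical all_reals all_analysis.

Set Implicit Arguments.
Unset Strict Implicit.
Unset Printing Implicit Defensive.

Import Order.TTheory GRing.Theory Num.Theory.

Local Open Scope classical_set_scope.
Local Open Scope ring_scope.

Definition topological_automorphism (H : topologicalZmodType) (f : H -> H) :=
  [/\ {morph f : x y / x + y}, continuous f &
      exists g : H -> H, [/\ cancel f g, cancel g f & continuous g]].

(* A group homomorphism phi : K -> Aut(H); [phi 1 = id] follows, see [phi1]. *)
Record topaut_action (K : finGroupType) (H : topologicalZmodType) := AutAction {
  phi_fun :> K -> H -> H;
  phi_topaut : forall k, topological_automorphism (phi_fun k);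
  phiM : forall k h x, phi_fun (k * h)%g x = phi_fun k (phi_fun h x) }.

Lemma phiD (K : finGroupType) (H : topologicalZmodType)
  (phi : topaut_action K H) k : {morph phi k : x y / x + y}.
Proof. by have [] := phi_topaut phi k. Qed.

Lemma phi_continuous (K : finGroupType) (H : topologicalZmodType)
  (phi : topaut_action K H) k : continuous (phi k).
Proof. by have [] := phi_topaut phi k. Qed.

Lemma phi1 (K : finGroupType) (H : topologicalZmodType)
  (phi : topaut_action K H) x : phi 1%g x = x.
Proof.
have [_ _ [g [phiK _ _]]] := phi_topaut phi 1%g.
by apply: (can_inj phiK); rewrite -phiM mulg1.
Qed.

Lemma phi0 (K : finGroupType) (H : topologicalZmodType)
  (phi : topaut_action K H) k : phi k 0 = 0.
Proof. by apply: (@addrI _ (phi k 0)); rewrite -phiD !addr0. Qed.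

Lemma phiN (K : finGroupType) (H : topologicalZmodType)
  (phi : topaut_action K H) k x : phi k (- x) = - phi k x.
Proof. by apply: (@addrI _ (phi k x)); rewrite -phiD !subrr phi0. Qed.

Definition sdgroup (K : finGroupType) (H : topologicalZmodType)
  (phi : topaut_action K H) : Type := (K * H)%type.

HB.instance Definition _ (K : finGroupType) (H : topologicalZmodType)
  (phi : topaut_action K H) := Choice.copy (sdgroup phi) (K * H)%type.

Definition sdmul (K : finGroupType) (H : topologicalZmodType)
    (phi : topaut_action K H) (g g' : sdgroup phi) : sdgroup phi :=
  ((g.1 * g'.1)%g, g.2 + phi g.1 g'.2).

Definition sdone (K : finGroupType) (H : topologicalZmodType)
  (phi : topaut_action K H) : sdgroup phi := (1%g, 0).

Definition sdinv (K : finGroupType) (H : topologicalZmodType)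
    (phi : topaut_action K H) (g : sdgroup phi) : sdgroup phi :=
  (g.1^-1%g, - phi g.1^-1%g g.2).

Lemma sdmulA K H phi : associative (@sdmul K H phi).
Proof. by move=> a b c; rewrite /sdmul/= mulgA phiD phiM addrA. Qed.

Lemma sdmul1g K H phi : left_id (sdone phi) (@sdmul K H phi).
Proof. by case=> k x; rewrite /sdmul/= mul1g phi1 add0r. Qed.

Lemma sdmulg1 K H phi : right_id (sdone phi) (@sdmul K H phi).
Proof. by case=> k x; rewrite /sdmul/= mulg1 phi0 addr0. Qed.

Lemma sdmulVg K H phi : left_inverse (sdone phi) (@sdinv K H phi) (@sdmul K H phi).
Proof. by case=> k x; rewrite /sdmul/= mulVg addNr. Qed.

Lemma sdmulgV K H phi : right_inverse (sdone phi) (@sdinv K H phi) (@sdmul K H phi).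
Proof. by case=> k x; rewrite /sdmul/= mulgV phiN -phiM mulgV phi1 subrr. Qed.

HB.instance Definition _ (K : finGroupType) (H : topologicalZmodType)
    (phi : topaut_action K H) :=
  isGroup.Build (sdgroup phi) (@sdmulA K H phi) (@sdmul1g K H phi)
    (@sdmulg1 K H phi) (@sdmulVg K H phi) (@sdmulgV K H phi).

Definition orbitH (K : finGroupType) (H : topologicalZmodType)
  (phi : topaut_action K H) (x : H) : set H := range (phi^~ x).

Definition orbits (K : finGroupType) (H : topologicalZmodType)
  (phi : topaut_action K H) : set (set H) := range (orbitH phi).

Definition is_section (K : finGroupType) (H : topologicalZmodType)
    (phi : topaut_action K H) (sigma : orbits phi -> H) : Prop :=
  forall y : orbits phi, val y (sigma y).

Record pdual (R : realType) (H : topologicalZmodType) := Character {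
  chr :> H -> R[i];
  chr_continuous : continuous (chr : H -> R[i]^o);
  chrD : forall x y, chr (x + y) = chr x * chr y;
  chr_norm : forall x, `|chr x| = 1 }.

HB.instance Definition _ (R : realType) (H : topologicalZmodType) :=
  gen_eqMixin (pdual R H).
HB.instance Definition _ (R : realType) (H : topologicalZmodType) :=
  gen_choiceMixin (pdual R H).

Lemma dual_ext (R : realType) (H : topologicalZmodType) (l m : pdual R H) :
  l =1 m -> l = m.
Proof.
case: l m => [l cl lD ln] [m cm mD mn]/= /funext lm; subst m.
by congr Character; exact: Prop_irrelevance.
Qed.

Lemma dact_continuous (R : realType) (K : finGroupType)
    (H : topologicalZmodType) (phi : topaut_action K H) (k : K) (l : pdual R H) :
  continuous ((fun x => l (phi k^-1%g x)) : H -> R[i]^o).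
Proof.
move=> x; exact: (continuous_comp (@phi_continuous _ _ phi k^-1%g x)
                                  (@chr_continuous _ _ l _)).
Qed.

Lemma dactD (R : realType) (K : finGroupType)
    (H : topologicalZmodType) (phi : topaut_action K H) (k : K) (l : pdual R H) x y :
  l (phi k^-1%g (x + y)) = l (phi k^-1%g x) * l (phi k^-1%g y).
Proof. by rewrite phiD chrD. Qed.

Definition dact (R : realType) (K : finGroupType)
    (H : topologicalZmodType) (phi : topaut_action K H) (k : K) (l : pdual R H)
  : pdual R H :=
  @Character R H (fun x => l (phi k^-1%g x)) (@dact_continuous R K H phi k l)
    (dactD phi k l) (fun x => chr_norm l (phi k^-1%g x)).

Definition trivial_stabilizer (R : realType) (K : finGroupType)
    (H : topologicalZmodType) (phi : topaut_action K H) (l : pdual R H) : Prop :=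
  forall k : K, dact phi k l = l -> k = 1%g.

Definition is_transversal_free (R : realType) (K : finGroupType)
    (H : topologicalZmodType) (phi : topaut_action K H) (S : set (pdual R H)) :=
  S `<=` trivial_stabilizer phi /\
  forall l : pdual R H, trivial_stabilizer phi l ->
    exists! m : pdual R H, S m /\ exists k : K, m = dact phi k l.

(* K is discrete, so continuity is void.  The dual of K is made a finType
   below: its elements take values in the #|K|-th roots of unity. *)
Definition is_kchar (R : realType) (K : finGroupType)
    (f : {ffun K -> R[i]}) : bool :=
  [forall k, forall h, f (k * h)%g == f k * f h] && [forall k, `|f k| == 1].

Record kdual (R : realType) (K : finGroupType) := KChar {
  kchr :> {ffun K -> R[i]};
  _ : is_kchar kchr }.

HB.instance Definition _ (R : realType) (K : finGroupType) :=
  [isSub for @kchr R K].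
HB.instance Definition _ (R : realType) (K : finGroupType) :=
  [Choice of kdual R K by <:].

Definition unity_roots (R : realType) (N : nat) : seq R[i] :=
  sval (closed_field_poly_normal ('X^N - 1 : {poly R[i]})).

Lemma kchr_unity (R : realType) (K : finGroupType) (n : kdual R K) (k : K) :
  n k \in unity_roots R #|K|.
Proof.
case: n => f /= /andP[/forallP fM /forallP f1].
have f1E : f 1%g = 1.
  have /forallP/(_ 1%g)/eqP := fM 1%g; rewrite mulg1 => e.
  apply: (@mulfI _ (f 1%g)); last by rewrite mulr1.
  by rewrite -normr_eq0 (eqP (f1 1%g)) oner_eq0.
have fX j : f (k ^+ j)%g = f k ^+ j.
  elim: j => [|j IH]; first by rewrite expg0 expr0.
  by have /forallP/(_ (k ^+ j)%g)/eqP := fM k; rewrite -expgS IH exprS.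
have K0 : (0 < #|K|)%N by apply/card_gt0P; exists k.
rewrite /unity_roots; case: closed_field_poly_normal => r /=.
have /eqP -> : lead_coef ('X^#|K| - 1 : {poly R[i]}) == 1.
  by rewrite -monicE monicXnsubC.
rewrite scale1r => re.
rewrite -root_prod_XsubC -re rootE !hornerE -fX -cardsT.
by rewrite expg_cardG ?inE// f1E subrr.
Qed.

Definition kdual_code (R : realType) (K : finGroupType) (n : kdual R K) :
    {ffun K -> seq_sub (unity_roots R #|K|)} :=
  [ffun k => SeqSub (kchr_unity n k)].

Definition kdual_decode (R : realType) (K : finGroupType)
    (c : {ffun K -> seq_sub (unity_roots R #|K|)}) : option (kdual R K) :=
  insub [ffun k => val (c k)].

Lemma kdual_codeK (R : realType) (K : finGroupType) :
  pcancel (@kdual_code R K) (@kdual_decode R K).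
Proof.
move=> n; rewrite /kdual_decode.
have -> : [ffun k => val (kdual_code n k)] = val n.
  by apply/ffunP => k; rewrite !ffunE.
exact: valK.
Qed.

HB.instance Definition _ (R : realType) (K : finGroupType) :=
  Countable.copy (kdual R K) (pcan_type (@kdual_codeK R K)).
HB.instance Definition _ (R : realType) (K : finGroupType) :=
  fintype.isFinite.Build (kdual R K) (pcan_enumP (@kdual_codeK R K)).

(* C^I is {ffun I -> R[i]}, and the tensor product of C^I, C^J and C^L is
   C^(I * J * L), with elementary tensors [tens]. *)

Definition dotc (R : realType) (I : finType) (u v : {ffun I -> R[i]}) : R[i] :=
  \sum_i u i * (v i)^*.

Definition basisC (R : realType) (I : finType) (i : I) : {ffun I -> R[i]} :=
  [ffun j => (j == i)%:R].

Definition tens (R : realType) (I J L : finType) (a : {ffun I -> R[i]})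
    (b : {ffun J -> R[i]}) (v : {ffun L -> R[i]}) : {ffun I * J * L -> R[i]} :=
  [ffun t => a t.1.1 * b t.1.2 * v t.2].

(* The conjugate transpose; see [dft_adjoint]. *)
Definition adjop (R : realType) (I J : finType)
    (A : {ffun I -> R[i]} -> {ffun J -> R[i]}) (w : {ffun J -> R[i]}) :
    {ffun I -> R[i]} :=
  [ffun i => dotc w (A (basisC R i))].

(* The operator id (x) A (x) id; see [tens_midE]. *)
Definition tens_mid (R : realType) (I J J' L : finType)
    (A : {ffun J -> R[i]} -> {ffun J' -> R[i]}) (u : {ffun I * J * L -> R[i]}) :
    {ffun I * J' * L -> R[i]} :=
  [ffun t => A [ffun j => u (t.1.1, j, t.2)] t.1.2].

Lemma tens_midE (R : realType) (I J J' L : finType)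
    (A : {ffun J -> R[i]} -> {ffun J' -> R[i]})
    (a : {ffun I -> R[i]}) (b : {ffun J -> R[i]}) (v : {ffun L -> R[i]}) :
  (forall (c : R[i]) (w : {ffun J -> R[i]}), A [ffun j => c * w j] = [ffun j => c * A w j]) ->
  tens_mid A (tens a b v) = tens a (A b) v.
Proof.
move=> AZ; apply/ffunP => -[[i j] l]; rewrite !ffunE/=.
have -> : [ffun j0 => tens a b v (i, j0, l)] = [ffun j0 => (a i * v l) * b j0].
  by apply/ffunP => j0; rewrite !ffunE/= mulrAC.
by rewrite AZ ffunE mulrAC.
Qed.

(* The bijection a (x) b (x) v |-> (a_i b_j v)_(i, j) for V = C^L; see
   [regroupE]. *)
Definition regroup (R : realType) (I J L : finType)
    (u : {ffun I * J * L -> R[i]}) : {ffun I * J -> {ffun L -> R[i]}} :=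
  [ffun t => [ffun l => u (t, l)]].

Definition regroup_inv (R : realType) (I J L : finType)
    (w : {ffun I * J -> {ffun L -> R[i]}}) : {ffun I * J * L -> R[i]} :=
  [ffun t => w t.1 t.2].

Lemma regroupE (R : realType) (I J L : finType) (a : {ffun I -> R[i]})
    (b : {ffun J -> R[i]}) (v : {ffun L -> R[i]}) (i : I) (j : J) (l : L) :
  regroup (tens a b v) (i, j) l = a i * b j * v l.
Proof. by rewrite !ffunE. Qed.

Lemma regroupK (R : realType) (I J L : finType) :
  cancel (@regroup R I J L) (@regroup_inv R I J L).
Proof. by move=> u; apply/ffunP => -[[i j] l]; rewrite !ffunE. Qed.

Lemma regroup_invK (R : realType) (I J L : finType) :
  cancel (@regroup_inv R I J L) (@regroup R I J L).
Proof. by move=> w; apply/ffunP => t; apply/ffunP => l; rewrite !ffunE. Qed.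

Definition dft (R : realType) (K : finGroupType) (v : {ffun K -> R[i]}) :
    {ffun kdual R K -> R[i]} :=
  [ffun n : kdual R K => (sqrtC (#|K|%:R : R[i]))^-1 * \sum_(h : K) (n h)^* * v h].

Lemma dft_adjoint (R : realType) (K : finGroupType) (v : {ffun K -> R[i]})
    (w : {ffun kdual R K -> R[i]}) :
  dotc (dft v) w = dotc v (adjop (@dft R K) w).
Proof.
have dftE (n : kdual R K) : dft v n = \sum_h v h * dft (basisC R h) n.
  rewrite ffunE mulr_sumr; apply: eq_bigr => h _; rewrite ffunE.
  rewrite [in RHS](bigD1 h)//= ffunE eqxx mulr1 big1 ?addr0; last first.
    by move=> j jh; rewrite ffunE (negbTE jh) mulr0.
  by rewrite mulrA mulrC.
rewrite /dotc; under eq_bigr do rewrite dftE mulr_suml.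
rewrite exchange_big/=; apply: eq_bigr => h _.
rewrite ffunE /dotc rmorph_sum mulr_sumr; apply: eq_bigr => n _.
rewrite rmorphM/= conjCK -mulrA.
by congr (_ * _); rewrite mulrC.
Qed.

Definition trep (R : realType) (K : finGroupType) (H : topologicalZmodType)
    (phi : topaut_action K H) (l : pdual R H) (g : sdgroup phi)
    (v : {ffun K -> R[i]}) : {ffun K -> R[i]} :=
  [ffun h => dact phi h l g.2 * v (g.1^-1 * h)%g].

Lemma trepM (R : realType) (K : finGroupType) (H : topologicalZmodType)
    (phi : topaut_action K H) (l : pdual R H) (g g' : sdgroup phi) v :
  trep l (g * g')%g v = trep l g (trep l g' v).
Proof.
case: g g' => [k x] [h y]; apply/ffunP => j; rewrite !ffunE/=.
by rewrite phiD chrD -phiM !invMg invgK !mulgA mulrA.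
Qed.

Definition AP (R : realType) (K : finGroupType) (H : topologicalZmodType)
    (phi : topaut_action K H) (F : {fset pdual R H}) : set (sdgroup phi -> R[i]) :=
  [set f | exists a : K -> K -> F -> R[i], forall g,
     f g = \sum_(l : F) \sum_(n : K) \sum_(m : K)
             dotc (trep (val l) g (basisC R n)) (basisC R m) * a n m l].

Definition FAP_inv (R : realType) (K : finGroupType) (H : topologicalZmodType)
    (phi : topaut_action K H) (F : {fset pdual R H})
    (u : {ffun K * K * F -> R[i]}) (g : sdgroup phi) : R[i] :=
  \sum_(l : F) \sum_(n : K) dact phi (n * g.1)%g (val l) g.2 * u (g.1, n, l).

(* The inverse of [FAP_inv], which is a bijection onto [AP F] when [F] is a
   subset of a transversal of the free orbits; junk value outside [AP F]. *)
Definition FAP (R : realType) (K : finGroupType) (H : topologicalZmodType)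
    (phi : topaut_action K H) (F : {fset pdual R H}) (f : sdgroup phi -> R[i]) :
    {ffun K * K * F -> R[i]} :=
  xget [ffun=> 0] [set u | FAP_inv u = f].

Definition sampl (R : realType) (K : finGroupType) (H : topologicalZmodType)
    (phi : topaut_action K H) (sigma : orbits phi -> H) (E : {fset orbits phi})
    (psi : sdgroup phi -> R[i]) : {ffun K * K * E -> R[i]} :=
  [ffun t => psi (t.1.1, phi t.1.2 (sigma (val t.2)))].

Definition ev (R : realType) (K : finGroupType) (H : topologicalZmodType)
    (phi : topaut_action K H) (sigma : orbits phi -> H) (E : {fset orbits phi})
    (F : {fset pdual R H}) (u : {ffun K * K * F -> R[i]}) :
    {ffun K * K * E -> R[i]} :=
  sampl sigma E (FAP_inv u).

Definition AP_interpolation (R : realType) (K : finGroupType)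
    (H : topologicalZmodType) (phi : topaut_action K H) (sigma : orbits phi -> H)
    (E : {fset orbits phi}) (F : {fset pdual R H})
    (Psi f : sdgroup phi -> R[i]) : Prop :=
  AP F f /\ ev sigma E (FAP F f) = sampl sigma E Psi.

Definition AP_well_posed (R : realType) (K : finGroupType)
    (H : topologicalZmodType) (phi : topaut_action K H) (sigma : orbits phi -> H)
    (E : {fset orbits phi}) (F : {fset pdual R H}) : Prop :=
  forall Psi : sdgroup phi -> R[i],
    exists! f : sdgroup phi -> R[i], AP_interpolation sigma E F Psi f.

Definition bessel (R : realType) (K : finGroupType) (H : topologicalZmodType)
    (phi : topaut_action K H) (sigma : orbits phi -> H) (n : kdual R K)
    (l : pdual R H) (y : orbits phi) : R[i] :=
  \sum_(r : K) l (phi r (sigma y)) * (n r)^*.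

Definition fourier_bessel (R : realType) (K : finGroupType)
    (H : topologicalZmodType) (phi : topaut_action K H) (sigma : orbits phi -> H)
    (E : {fset orbits phi}) (F : {fset pdual R H})
    (u : {ffun K * kdual R K -> {ffun F -> R[i]}}) :
    {ffun K * kdual R K -> {ffun E -> R[i]}} :=
  [ffun t : K * kdual R K => [ffun y : E =>
     (t.2 t.1)^* * \sum_(l : F) bessel sigma t.2 (val l) (val y) * u t l]].

Arguments ev {R K H phi} sigma E F u.
Arguments fourier_bessel {R K H phi} sigma E F u.

(* Main.v *)
(* Fourier inversion on K turns the Fourier transform (in r) of
   r |-> lambda (phi r (sigma y)), which is the Bessel function, back into the
   values of lambda on the orbit; this gives the factorization of [ev].

   The Fourier factors are bijective, so the second claim is that well-posedness
   is equivalent to the bijectivity of [ev].  The stabilizer of sigma y may be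
   nontrivial, in which case [sampl] is not onto and well-posedness does not
   give the surjectivity of [ev] directly.  Instead, well-posedness makes [ev]
   injective, and interpolating functions that depend only on the orbit makes
   the Bessel matrix of the trivial character surjective, so |E| <= |F|; then
   [ev] is bijective by dimension count. *)

Require Import Defs.
From mathcomp Require Import all_boot all_order all_algebra all_fingroup.
From mathcomp Require Import finmap complex.
From mathcomp Require Import all_classical all_reals all_analysis.
From mathcomp Require Import cyclic separable cyclotomic mxrepresentation.

Set Implicit Arguments.
Unset Strict Implicit.
Unset Printing Implicit Defensive.

Import Order.TTheory GRing.Theory Num.Theory.

Local Open Scope ring_scope.

(** * Characters of a finite abelian group *)

Lemma diagonalizable_expr1 (C : numClosedFieldType) (n N : nat) (A : 'M[C]_n.+1) :
  (0 < N)%N -> A ^+ N = 1 -> diagonalizable A.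
Proof.
move=> N0 AN; apply/diagonalizableP.
case: (closed_field_poly_normal ('X^N - 1 : {poly C})) => rs.
have /eqP -> : lead_coef ('X^N - 1 : {poly C}) == 1 by rewrite -monicE monicXnsubC.
(* ['X^N - 1] annihilates [A], splits over [C], and has simple roots since [N] is nonzero in
   characteristic zero. *)
rewrite scale1r => rsE; exists rs.
  rewrite -separable_prod_XsubC -rsE separable_Xn_sub_1//.
  by rewrite pnatr_eq0 -lt0n.
rewrite -rsE; apply: mxminpoly_min.
by rewrite rmorphB/= rmorphXn/= horner_mx_X rmorph1 AN subrr.
Qed.

Lemma kdualM {R : realType} {K : finGroupType} (n : kdual R K) g h :
  n (g * h)%g = n g * n h.
Proof. by case: n => f /= /andP[/forallP/(_ g)/forallP/(_ h)/eqP]. Qed.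

Lemma kdual_norm {R : realType} {K : finGroupType} (n : kdual R K) g : `|n g| = 1.
Proof. by case: n => f /= /andP[_ /forallP/(_ g)/eqP]. Qed.

(* The diagonal entries, in a common eigenbasis, of a faithful matrix
   representation (the regular one) are characters. *)
Lemma kdual_separates (R : realType) (K : finGroupType) (g : K) :
  abelian [set: K]%SET -> g != 1%g -> exists n : kdual R K, n g != 1.
Proof.
move=> Kab g1; set G := [set: K]%G.
(* Square matrices form a ring only in successor size, and powers of [rG k] are needed below. *)
have [n nE] : exists n, #|G| = n.+1.
  by exists (#|G|.-1); rewrite prednK// cardG_gt0.
have := @regular_mx_faithful R[i] _ G.
move: (@regular_repr R[i] _ G); rewrite /mx_faithful.
rewrite /gcard nE => rG /fintype.subsetP/(_ g) rG1.
have rgM k h : rG (k * h)%g = rG k * rG h by rewrite repr_mxM ?inE.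
have rgX k j : rG (k ^+ j)%g = rG k ^+ j.
  elim: j => [|j IH]; first by rewrite expg0 repr_mx1.
  by rewrite expgS rgM IH exprS.
have kN (k : K) : (k ^+ n.+1)%g = 1%g by rewrite -nE; rewrite expg_cardG ?inE.
(* The matrices [rG k] commute, and each has finite order, hence is diagonalizable; so one [P]
   diagonalizes them all. *)
have [P Pu /allP PD] : codiagonalizable [seq rG k | k <- enum K].
  apply/codiagonalizableP; split.
    move=> _ _ /mapP[k _ ->] /mapP[h _ ->]; rewrite /comm_mx !mulmxE -!rgM.
    by congr (rG _); apply: (centsP Kab); rewrite inE.
  by move=> _ /mapP[k _ ->]; apply: (@diagonalizable_expr1 _ _ n.+1);
    rewrite // -rgX kN repr_mx1.
pose X k := P *m rG k *m invmx P.
have XD k (i j : 'I_n.+1) : i != j -> X k i j = 0.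
  move=> ij; have /PD/= : rG k \in [seq rG k | k <- enum K].
    by apply: map_f; rewrite mem_enum.
  by move=> /(similar_diagP _ Pu); apply.
have X1 : X 1%g = 1%:M by rewrite /X repr_mx1 mulmx1 mulmxV.
have XM k h : X (k * h)%g = X k *m X h.
  by rewrite /X rgM -!mulmxE !mulmxA mulmxKV.
pose chi i : {ffun K -> R[i]} := [ffun k => X k i i].
have chiM i k h : chi i (k * h)%g = chi i k * chi i h.
  rewrite !ffunE XM mxE (bigD1 i)//= big1 ?addr0// => j ji.
  by rewrite XD ?mul0r// eq_sym.
have chi1 i : chi i 1%g = 1 by rewrite ffunE X1 mxE eqxx.
have chi_char i : is_kchar (chi i).
  apply/andP; split; first by apply/forallP => k; apply/forallP => h; rewrite chiM.
  apply/forallP => k.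
  have chiX j : chi i (k ^+ j)%g = chi i k ^+ j.
    by elim: j => [|j IH]; rewrite ?expg0 ?chi1// expgS chiM IH exprS.
  by rewrite -(@pexpr_eq1 _ _ n.+1)// -normrX -chiX kN chi1 normr1.
(* If every diagonal character were 1 at [g], then [rG g] would be the identity, against
   faithfulness. *)
have [[i Xi]|X1g] := pselect (exists i, chi i g != 1); first by exists (KChar (chi_char i)).
have Xg : X g = 1%:M.
  apply/matrixP => i j; rewrite [RHS]mxE; have [<-|/XD//] := eqVneq i j.
  by apply: contrapT => /eqP H; apply: X1g; exists i; rewrite ffunE.
have /rG1 : g \in rker rG.
  rewrite inE inE /= mul1mx; apply/eqP.
  have : invmx P *m X g *m P = rG g by rewrite /X !mulmxA mulVmx// mul1mx mulmxKV.
  by rewrite Xg mulmx1 mulVmx.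
by rewrite inE (negbTE g1).
Qed.

Lemma kdual_neq0 {R : realType} {K : finGroupType} (n : kdual R K) g : n g != 0.
Proof. by rewrite -normr_eq0 kdual_norm oner_eq0. Qed.

Lemma kdual1 {R : realType} {K : finGroupType} (n : kdual R K) : n 1%g = 1.
Proof. by apply: (mulfI (kdual_neq0 n 1%g)); rewrite -kdualM mulg1 mulr1. Qed.

Lemma kdualV {R : realType} {K : finGroupType} (n : kdual R K) g :
  n g^-1%g = (n g)^*.
Proof.
apply: (mulfI (kdual_neq0 n g)).
by rewrite -kdualM mulgV kdual1 -normCK kdual_norm expr1n.
Qed.

Lemma is_kchar1 (R : realType) (K : finGroupType) :
  is_kchar ([ffun=> 1] : {ffun K -> R[i]}).
Proof.
apply/andP; split; apply/forallP => k; last by rewrite ffunE normr1.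
by apply/forallP => h; rewrite !ffunE mulr1.
Qed.

Definition ktriv (R : realType) (K : finGroupType) : kdual R K :=
  KChar (is_kchar1 R K).

Lemma is_kcharM (R : realType) (K : finGroupType) (n m : kdual R K) :
  is_kchar [ffun k => n k * m k].
Proof.
apply/andP; split; apply/forallP => k.
  by apply/forallP => h; rewrite !ffunE !kdualM mulrACA.
by rewrite ffunE normrM !kdual_norm mulr1.
Qed.

Definition kmul (R : realType) (K : finGroupType) (n m : kdual R K) : kdual R K :=
  KChar (is_kcharM n m).

Lemma kdual_ext (R : realType) (K : finGroupType) (n m : kdual R K) :
  n =1 m -> n = m.
Proof. by move=> nm; apply/val_inj/ffunP. Qed.

Lemma kmulI (R : realType) (K : finGroupType) (n : kdual R K) :
  injective (kmul n).
Proof.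
move=> m m' e; apply: kdual_ext => k; apply: (mulfI (kdual_neq0 n k)).
by have := congr1 (fun n : kdual R K => n k) e; rewrite /= !ffunE.
Qed.

(** Translating the summation index by a [g] with [m g * (n g)^* != 1] multiplies the sum by that
    factor without changing it, so the sum vanishes. *)
Lemma kdual_orthogonal (R : realType) (K : finGroupType) (n m : kdual R K) :
  m != n -> \sum_g m g * (n g)^* = 0.
Proof.
move=> mn; have [g mng] : exists g, m g * (n g)^* != 1.
  apply: contrapT => H; move/eqP: mn; apply; apply: kdual_ext => g.
  have : m g * (n g)^* = 1 by apply: contrapT => /eqP ?; apply: H; exists g.
  rewrite -kdualV => /(congr1 ( *%R^~ (n g))).
  by rewrite -mulrA -kdualM mulVg kdual1 mulr1 mul1r.
apply/eqP; move: mng; rewrite -subr_eq0 => mng.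
rewrite -(mulrI_eq0 _ (mulfI mng)) mulrBl mul1r mulr_sumr subr_eq0.
rewrite [X in _ == X](reindex_inj (mulgI g)).
by apply/eqP/eq_bigr => h _; rewrite !kdualM rmorphM/= mulrACA.
Qed.

(** The translation argument again, now in the dual group, with a character [m] that separates [g]
    from 1. *)
Lemma sum_kdual_neq1 (R : realType) (K : finGroupType) (g : K) :
  abelian [set: K]%SET -> g != 1%g -> \sum_(n : kdual R K) n g = 0.
Proof.
move=> Kab /(kdual_separates R Kab)[m mg].
apply/eqP; move: mg; rewrite -subr_eq0 => mg.
rewrite -(mulrI_eq0 _ (mulfI mg)) mulrBl mul1r mulr_sumr subr_eq0.
rewrite [X in _ == X](reindex_inj (@kmulI _ _ m)).
by apply/eqP/eq_bigr => h _; rewrite ffunE.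
Qed.

(** Double counting of the sum of all [n g]: in one order only [g = 1] contributes, in the other
    only the trivial character. *)
Lemma card_kdual (R : realType) (K : finGroupType) :
  abelian [set: K]%SET -> #|{: kdual R K}|%:R = #|K|%:R :> R[i].
Proof.
move=> Kab; have : \sum_g \sum_(n : kdual R K) n g = \sum_(n : kdual R K) \sum_g n g.
  by rewrite exchange_big.
rewrite (bigD1 1%g)//= [X in _ + X = _]big1 ?addr0; last by move=> g g1; exact: sum_kdual_neq1.
under eq_bigr do rewrite kdual1.
rewrite sumr_const (bigD1 (ktriv R K))//= [X in _ = _ + X]big1 ?addr0; last first.
  move=> n n1; rewrite -[RHS](kdual_orthogonal n1); apply: eq_bigr => g _.
  by rewrite ffunE conjC1 mulr1.
under [X in _ = X]eq_bigr do rewrite ffunE.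
by rewrite sumr_const.
Qed.

Lemma sum_kdual (R : realType) (K : finGroupType) (g : K) :
  abelian [set: K]%SET -> \sum_(n : kdual R K) n g = (g == 1%g)%:R * #|K|%:R.
Proof.
move=> Kab; have [->|g1] := eqVneq g 1%g; last by rewrite mul0r sum_kdual_neq1.
by under eq_bigr do rewrite kdual1; rewrite sumr_const mul1r card_kdual.
Qed.

Lemma kdual_inversion (R : realType) (K : finGroupType) (f : K -> R[i]) h :
  abelian [set: K]%SET ->
  \sum_(n : kdual R K) n h * \sum_r f r * (n r)^* = #|K|%:R * f h.
Proof.
move=> Kab; under eq_bigr do rewrite mulr_sumr.
rewrite exchange_big/=.
under eq_bigr => r _.
  under eq_bigr do rewrite mulrCA -kdualV -kdualM.
  rewrite -mulr_sumr sum_kdual//.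
over.
rewrite (bigD1 h)//= mulgV eqxx mul1r mulrC big1 ?addr0// => r rh.
by rewrite -eq_mulgV1 eq_sym (negbTE rh) mul0r mulr0.
Qed.

(** * Unitarity of the discrete Fourier transform *)

Lemma invr_sqrtC_sqr (C : numClosedFieldType) (x : C) :
  (sqrtC x)^-1 * (sqrtC x)^-1 = x^-1.
Proof. by rewrite -invfM -expr2 sqrtCK. Qed.

Lemma natr_cardG_neq0 (C : numDomainType) (K : finGroupType) : #|K|%:R != 0 :> C.
Proof. by rewrite pnatr_eq0 -lt0n; apply/card_gt0P; exists 1%g. Qed.

Lemma adjop_dftE (R : realType) (K : finGroupType) (w : {ffun kdual R K -> R[i]}) h :
  adjop (@dft R K) w h = (sqrtC (#|K|%:R : R[i]))^-1 * \sum_(n : kdual R K) n h * w n.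
Proof.
rewrite ffunE /dotc mulr_sumr; apply: eq_bigr => n _.
rewrite ffunE (bigD1 h)//= big1 ?addr0; last first.
  by move=> j jh; rewrite ffunE (negbTE jh) mulr0.
rewrite ffunE eqxx mulr1 rmorphM/= conjCK mulrC -mulrA; congr (_ * _).
(* The normalizing factor is real, hence fixed by the conjugation in [dotc]. *)
by apply: CrealP; rewrite realV ger0_real// sqrtC_ge0 ler0n.
Qed.

Lemma dftK (R : realType) (K : finGroupType) : abelian [set: K]%SET ->
  cancel (@dft R K) (adjop (@dft R K)).
Proof.
move=> Kab v; apply/ffunP => h; rewrite adjop_dftE.
under eq_bigr do rewrite ffunE mulrCA.
rewrite -mulr_sumr mulrA invr_sqrtC_sqr.
under eq_bigr => n _ do under [X in _ * X]eq_bigr do rewrite mulrC.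
by rewrite kdual_inversion// mulKf// natr_cardG_neq0.
Qed.

(** This side rests on orthogonality of characters summed over [K], whereas [dftK] rests on sums
    over the dual. *)
Lemma adjop_dftK (R : realType) (K : finGroupType) :
  cancel (adjop (@dft R K)) (@dft R K).
Proof.
move=> w; apply/ffunP => n; rewrite ffunE.
under eq_bigr do rewrite adjop_dftE mulrCA mulr_sumr.
rewrite -mulr_sumr mulrA invr_sqrtC_sqr exchange_big/=.
under eq_bigr => m _.
  under eq_bigr do rewrite mulrA [_^* * _]mulrC.
  rewrite -mulr_suml.
over.
rewrite (bigD1 n)//= [X in _ * (_ + X)]big1 ?addr0; last first.
  by move=> m mn; rewrite kdual_orthogonal// mul0r.
under eq_bigr do rewrite -normCK kdual_norm expr1n.
by rewrite sumr_const mulKf// natr_cardG_neq0.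
Qed.

Lemma tens_mid_can (R : realType) (I J J' L : finType)
    (A : {ffun J -> R[i]} -> {ffun J' -> R[i]}) (B : {ffun J' -> R[i]} -> {ffun J -> R[i]}) :
  cancel A B -> cancel (@tens_mid R I J J' L A) (@tens_mid R I J' J L B).
Proof.
move=> AB u; apply/ffunP => -[[i j] l]; rewrite ffunE/=.
have -> : [ffun j0 => tens_mid A u (i, j0, l)] = A [ffun j => u (i, j, l)].
  by apply/ffunP => j0; rewrite !ffunE.
by rewrite AB ffunE.
Qed.

(** * Factorization of the evaluation operator *)

Lemma evE (R : realType) (K : finGroupType) (H : topologicalZmodType)
    (phi : topaut_action K H) (sigma : orbits phi -> H) (E : {fset orbits phi})
    (F : {fset pdual R H}) u k h y :
  ev sigma E F u (k, h, y) = \sum_(l : F) \sum_n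
    val l (phi ((n * k)^-1 * h)%g (sigma (val y))) * u (k, n, l).
Proof.
rewrite ffunE/= /FAP_inv/=; apply: eq_bigr => l _; apply: eq_bigr => n _.
by rewrite phiM.
Qed.

(** For fixed [k] and [l], [evE] is a convolution over [K] of [u (k, _, l)] with
    [r |-> l (phi r z)], evaluated at [k^-1 * h]. The Fourier transform turns it into multiplication
    by the Bessel function, and the shift by [k^-1] gives the factor [(n k)^*]. *)
Lemma ev_decomposition (R : realType) (K : finGroupType) (H : topologicalZmodType)
    (phi : topaut_action K H) (sigma : orbits phi -> H) (E : {fset orbits phi})
    (F : {fset pdual R H}) : abelian [set: K]%SET ->
  ev sigma E F =1
    tens_mid (adjop (@dft R K)) \o @regroup_inv R K (kdual R K) E
      \o fourier_bessel sigma E F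
      \o @regroup R K (kdual R K) F \o tens_mid (@dft R K).
Proof.
move=> Kab u; apply/ffunP => -[[k h] y]; rewrite evE/= ffunE/= adjop_dftE.
set c := (sqrtC _)^-1; set z := sigma (val y).
under [in RHS]eq_bigr => n _.
  rewrite !ffunE/= mulrA [X in _ * X](_ : _ =
      c * \sum_(l : F) \sum_m bessel sigma n (val l) (val y) * ((n m)^* * u (k, m, l))); last first.
    rewrite mulr_sumr; apply: eq_bigr => l _.
    rewrite !ffunE/= mulrCA; congr (_ * _); rewrite mulr_sumr.
    by apply: eq_bigr => m _; rewrite ffunE.
  rewrite mulrCA mulr_sumr.
over.
rewrite -mulr_sumr mulrA invr_sqrtC_sqr [in RHS]exchange_big/= [RHS]mulr_sumr.
apply: eq_bigr => l _.
under [in RHS]eq_bigr do rewrite mulr_sumr.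
rewrite [in RHS]exchange_big/= [RHS]mulr_sumr; apply: eq_bigr => m _.
(* Fourier inversion at [(m * k)^-1 * h]. Splitting the character there gives [(n m)^*] for [dft],
   [(n k)^*] for [fourier_bessel] and [n h] for the adjoint. *)
transitivity ((#|K|%:R)^-1 * ((\sum_(n : kdual R K) n ((m * k)^-1 * h)%g *
    \sum_r val l (phi r z) * (n r)^* ) * u (k, m, l))).
  by rewrite kdual_inversion// -mulrA mulKf// natr_cardG_neq0.
congr (_ * _); rewrite mulr_suml; apply: eq_bigr => n _.
rewrite kdualM kdualV kdualM rmorphM/= /bessel -/z.
rewrite [X in _ = _ * X]mulrCA !mulrA; congr (_ * _ * _).
by rewrite mulrC [X in _ * X]mulrC mulrA.
Qed.

(** * Independence of characters and uniqueness of the AP coefficients *)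

Lemma multiplicative_independent (V : zmodType) (C : fieldType) (I : finType)
    (chi : I -> V -> C) (c : I -> C) :
  (forall i x y, chi i (x + y) = chi i x * chi i y) -> (forall i, chi i 0 != 0) ->
  (forall i j, chi i =1 chi j -> i = j) ->
  (forall x, \sum_i c i * chi i x = 0) -> forall i, c i = 0.
Proof.
move=> chiD chi0 chi_inj c0 i.
(* Dedekind's argument: induction on the number of terms, with the coefficients left arbitrary. *)
suff H n : forall (A : {set I}) (d : I -> C), #|A| = n ->
    (forall x, \sum_(i in A) d i * chi i x = 0) -> forall i, i \in A -> d i = 0.
  apply: (H #|[set: I]%SET| [set: I]%SET c erefl); last by rewrite finset.in_setT.
  by move=> x; under eq_bigl do rewrite finset.in_setT.
elim: n => [|n IH] {}A {}d.
  by move=> /eqP; rewrite cards_eq0 => /eqP -> _ j; rewrite finset.in_set0.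
move=> cardA dA j jA.
have d0 a : a \in A -> a != j -> d a = 0.
  move=> aA aj; have [y jy] : exists y, chi a y != chi j y.
    apply: contrapT => H; move/eqP: aj; apply; apply: chi_inj => y.
    by apply: contrapT => /eqP ay; apply: H; exists y.
  (* Subtracting [chi j y] times the relation at [x] from the relation at [y + x] eliminates the
     term [j]. *)
  have : d a * (chi a y - chi j y) = 0.
    apply: (IH (A :\ j)%SET (fun a => d a * (chi a y - chi j y))).
    - by have := cardsD1 j A; rewrite jA cardA => -[].
    - move=> x; have := dA (y + x); rewrite (big_setD1 j)//=.
      have := dA x; rewrite (big_setD1 j)//= => /eqP; rewrite addr_eq0 => /eqP e.
      rewrite chiD mulrCA e => {}e; rewrite -[RHS]e mulrN mulr_sumr addrC -sumrB.
      by apply: eq_bigr => b _; rewrite chiD mulrBr mulrBl mulrA mulrCA mulrA.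
    - by rewrite !inE aj.
  by move=> /eqP; rewrite mulf_eq0 subr_eq0 (negbTE jy) orbF => /eqP.
have /eqP := dA 0; rewrite (big_setD1 j)//= big1 ?addr0; last first.
  by move=> b; rewrite !inE => /andP[bj bA]; rewrite d0// mul0r.
by rewrite mulf_eq0 (negbTE (chi0 j)) orbF => /eqP.
Qed.

Lemma dactM (R : realType) (K : finGroupType) (H : topologicalZmodType)
    (phi : topaut_action K H) a b (l : pdual R H) :
  dact phi a (dact phi b l) = dact phi (a * b)%g l.
Proof. by apply: dual_ext => x /=; rewrite -phiM invMg. Qed.

Lemma dact1 (R : realType) (K : finGroupType) (H : topologicalZmodType)
    (phi : topaut_action K H) (l : pdual R H) : dact phi 1%g l = l.
Proof. by apply: dual_ext => x /=; rewrite invg1 phi1. Qed.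

(** Both [l] and [m] represent the orbit of [l], so they coincide; freeness then forces
    [b^-1 * a = 1]. Hence the characters occurring in [FAP_inv] at a fixed [k] are pairwise
    distinct. *)
Lemma dact_transversal_inj (R : realType) (K : finGroupType)
    (H : topologicalZmodType) (phi : topaut_action K H) (S : set (pdual R H)) a b l m :
  is_transversal_free phi S -> S l -> S m -> dact phi a l = dact phi b m ->
  a = b /\ l = m.
Proof.
move=> [Sfree Suniq] Sl Sm e.
have me : m = dact phi (b^-1 * a)%g l by rewrite -dactM e dactM mulVg dact1.
have lm : l = m.
  have [p [_ pU]] := Suniq _ (Sfree _ Sl).
  rewrite -(pU l) ?(pU m)//; split=> //; first by exists (b^-1 * a)%g.
  by exists 1%g; rewrite dact1.
split=> //; have /eqP := Sfree _ Sl (b^-1 * a)%g (etrans (esym me) (esym lm)).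
by rewrite -eq_mulVg1 => /eqP.
Qed.

(** As [K] is abelian, the matrix coefficient at [(n, m)] vanishes unless [m = n * g.1], so the sum
    over [m] collapses. The coefficients correspond by [u (k, n, l) = a n (n * k) l]. *)
Lemma AP_FAP_inv (R : realType) (K : finGroupType) (H : topologicalZmodType)
    (phi : topaut_action K H) (F : {fset pdual R H}) (f : sdgroup phi -> R[i]) :
  abelian [set: K]%SET -> AP F f <-> exists u, f = @FAP_inv R K H phi F u.
Proof.
move=> Kab.
have dotE (l : F) (n m : K) (g : sdgroup phi) :
    dotc (trep (val l) g (basisC R n)) (basisC R m) =
    dact phi m (val l) g.2 * (m == n * g.1)%g%:R.
  rewrite /dotc (bigD1 m)//= big1 ?addr0; last first.
    by move=> j jm; rewrite [basisC R m j]ffunE (negbTE jm) conjC0 mulr0.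
  rewrite [basisC R m m]ffunE eqxx conjC1 mulr1 ffunE; congr (_ * _).
  rewrite ffunE -(inj_eq (mulgI g.1)) mulKVg.
  by rewrite (centsP Kab g.1 _ n) ?finset.in_setT.
have sumE (a : K -> K -> F -> R[i]) (g : sdgroup phi) :
    \sum_(l : F) \sum_(n : K) \sum_(m : K)
      dotc (trep (val l) g (basisC R n)) (basisC R m) * a n m l =
    \sum_(l : F) \sum_(n : K) dact phi (n * g.1)%g (val l) g.2 * a n (n * g.1)%g l.
  apply: eq_bigr => l _; apply: eq_bigr => n _.
  rewrite (bigD1 (n * g.1)%g)//= big1 ?addr0 => [|m mn].
    by rewrite dotE eqxx mulr1.
  by rewrite dotE (negbTE mn) mulr0 mul0r.
split=> [[a fa]|[u ->]].
  exists [ffun t => a t.1.2 (t.1.2 * t.1.1)%g t.2]; apply/funext => g.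
  rewrite fa sumE /FAP_inv; apply: eq_bigr => l _; apply: eq_bigr => n _.
  by rewrite ffunE.
exists (fun n m l => u (n^-1 * m, n, l)%g) => g; rewrite sumE /FAP_inv.
by apply: eq_bigr => l _; apply: eq_bigr => n _; rewrite mulKg.
Qed.

Section Transversal.
Variables (R : realType) (K : finGroupType) (H : topologicalZmodType).
Variables (phi : topaut_action K H) (S : set (pdual R H)) (F : {fset pdual R H}).
Hypotheses (Sphi : is_transversal_free phi S) (FS : ([set` F] `<=` S)%classic).

(** At each fixed [k], the values are a combination of distinct characters of [H] indexed by
    [(l, n)], so independence determines the coefficients. *)
Lemma FAP_inv_inj : injective (@FAP_inv R K H phi F).
Proof.
move=> u v uv; apply/ffunP => -[[k n] l]; apply/eqP; rewrite -subr_eq0.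
pose chi (i : F * K) : H -> R[i] := dact phi (i.2 * k)%g (val i.1).
pose c (i : F * K) := u (k, i.2, i.1) - v (k, i.2, i.1).
apply/eqP; apply: (@multiplicative_independent H _ _ chi c _ _ _ _ (l, n)).
- by move=> i x y; rewrite /chi chrD.
- by move=> i; rewrite /chi -normr_eq0 chr_norm oner_eq0.
- move=> [l1 n1] [l2 n2] /dual_ext/= e.
  have [/mulIg -> /val_inj ->//] :=
    dact_transversal_inj Sphi (FS (valP l1)) (FS (valP l2)) e.
- move=> x; have := congr1 (fun f => f (k, x)) uv; rewrite /FAP_inv/=.
  rewrite !pair_bigA/= => /eqP; rewrite -subr_eq0 -sumrB => /eqP e.
  by rewrite -[RHS]e; apply: eq_bigr => i _; rewrite -mulrBr mulrC.
Qed.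

Lemma FAP_invK u : FAP F (@FAP_inv R K H phi F u) = u.
Proof.
apply: FAP_inv_inj; rewrite /FAP.
exact: (@xgetPex _ _ [set v | FAP_inv v = FAP_inv u]%classic (ex_intro _ u erefl)).
Qed.

End Transversal.

(** * Dimension count *)

Lemma surjective_form_leq_card (C : fieldType) (I J : finType) (A : I -> J -> C) :
  (forall v : J -> C, exists w : I -> C, forall j, v j = \sum_i w i * A i j) ->
  (#|J| <= #|I|)%N.
Proof.
move=> surj.
pose M : 'M[C]_(#|I|, #|J|) := \matrix_(i, j) A (enum_val i) (enum_val j).
(* Solving for the indicator functions of [J] gives a left inverse of [M], whose rank is therefore
   [#|J|]. *)
have [B BE] : exists B : J -> I -> C, forall k j, (k == j)%:R = \sum_i B k i * A i j.
  by have [B BP] := choice (fun k : J => surj (fun j => (k == j)%:R)); exists B.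
have /row_fullP/eqP : exists B, B *m M = 1%:M.
  exists (\matrix_(k, i) B (enum_val k) (enum_val i)); apply/matrixP => k j.
  rewrite !mxE -(inj_eq enum_val_inj) BE (reindex _ (onW_bij _ (@enum_val_bij I)))/=.
  by apply: eq_bigr => i _; rewrite !mxE.
by move=> <-; exact: rank_leq_row.
Qed.

Lemma injective_form_surjective (C : fieldType) (I J : finType) (A : I -> J -> C) :
  (#|J| <= #|I|)%N ->
  (forall w : I -> C, (forall j, \sum_i w i * A i j = 0) -> forall i, w i = 0) ->
  forall v : J -> C, exists w : I -> C, forall j, v j = \sum_i w i * A i j.
Proof.
move=> JI inj v.
pose M : 'M[C]_(#|I|, #|J|) := \matrix_(i, j) A (enum_val i) (enum_val j).
have Mfree : row_free M.
  apply/inj_row_free => w wM; apply/rowP => i; rewrite mxE -(enum_valK i).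
  apply: (inj (fun i => w 0 (enum_rank i))) => j.
  have := congr1 (fun N : 'rV[C]_#|J| => N 0 (enum_rank j)) wM; rewrite !mxE => e.
  rewrite -[RHS]e (reindex _ (onW_bij _ (@enum_val_bij I)))/=.
  by apply: eq_bigr => k _; rewrite !mxE enum_valK enum_rankK.
(* Injectivity makes the rank [#|I|], which is at least [#|J|], so the rank attains its upper bound
   [#|J|]. *)
have /row_fullP[B BM] : row_full M.
  by rewrite /row_full eqn_leq rank_leq_col (eqP Mfree).
pose w := (\row_j v (enum_val j)) *m B.
exists (fun i => w 0 (enum_rank i)) => j.
have : w *m M = \row_j v (enum_val j) by rewrite -mulmxA BM mulmx1.
move=> /(congr1 (fun N : 'rV[C]_#|J| => N 0 (enum_rank j))); rewrite !mxE enum_rankK => <-.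
rewrite (reindex _ (onW_bij _ (@enum_val_bij I)))/=.
by apply: eq_bigr => k _; rewrite !mxE enum_valK enum_rankK.
Qed.

Section Evaluation.
Variables (R : realType) (K : finGroupType) (H : topologicalZmodType).
Variables (phi : topaut_action K H) (sigma : orbits phi -> H).
Variables (E : {fset orbits phi}) (F : {fset pdual R H}).

Lemma ev_sum_basisC (u : {ffun K * K * F -> R[i]}) t :
  ev sigma E F u t = \sum_s u s * ev sigma E F (basisC R s) t.
Proof.
case: t => -[k h] y; under eq_bigr do rewrite evE mulr_sumr.
rewrite evE [in RHS]exchange_big/=; apply: eq_bigr => l _.
under [in RHS]eq_bigr do rewrite mulr_sumr.
rewrite [in RHS]exchange_big/=; apply: eq_bigr => n _.
rewrite (bigD1 (k, n, l))//= big1 ?addr0; last first.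
  by move=> s sn; rewrite ffunE eq_sym (negbTE sn) !mulr0.
by rewrite ffunE eqxx mulr1 mulrC.
Qed.

Lemma ev_bijective : injective (ev sigma E F) -> (#|{: E}| <= #|{: F}|)%N ->
  bijective (ev sigma E F).
Proof.
move=> inj EF.
have /choice[g gK] : forall v, exists u, ev sigma E F u = v.
  move=> v.
  have [||w wv] := @injective_form_surjective _ _ _
    (fun s t => ev sigma E F (basisC R s) t) _ _ v.
  - by rewrite !card_prod leq_mul2l EF orbT.
  - move=> w w0 s.
    (* Triviality of the kernel comes from comparing the image of [w] with that of the zero
       function. *)
    have : finfun w = [ffun=> 0].
      apply: inj; apply/ffunP => t; rewrite !ev_sum_basisC -[LHS]/(_ : R[i]).
      under eq_bigr do rewrite ffunE; rewrite w0 big1// => s' _.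
      by rewrite ffunE mul0r.
    by move=> /ffunP/(_ s); rewrite !ffunE.
  exists (finfun w); apply/ffunP => t; rewrite ev_sum_basisC wv.
  by apply: eq_bigr => s _; rewrite ffunE.
by exists g => // u; apply: inj; rewrite gK.
Qed.

End Evaluation.

(** * Orbits and well-posedness *)

Lemma orbits_eqE (K : finGroupType) (H : topologicalZmodType)
    (phi : topaut_action K H) (y z : orbits phi) x h :
  val y x -> val z (phi h x) = (z = y) :> Prop.
Proof.
(* An orbit is generated by any of its points, not only by its original base point. *)
have closed (w : orbits phi) a b : val w a -> val w b = (exists k, b = phi k a).
  have /= [c _ <-] := set_valP w => -[k _ <-]; apply/propext; split.
    by move=> [j _ <-]; exists (j * k^-1)%g; rewrite -phiM mulgKV.
  by move=> [j ->]; exists (j * k)%g; rewrite // phiM.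
move=> yx; apply/propext; split=> [zx|->]; last first.
  by rewrite (closed _ _ _ yx); exists h.
apply/val_inj/funext => b; rewrite (closed _ _ _ zx) (closed _ _ _ yx).
apply/propext; split=> -[k ->]; first by exists (k * h)%g; rewrite phiM.
by exists (k * h^-1)%g; rewrite -phiM mulgKV.
Qed.

Section WellPosed.
Variables (R : realType) (K : finGroupType) (H : topologicalZmodType).
Variables (phi : topaut_action K H) (S : set (pdual R H)).
Variables (sigma : orbits phi -> H) (F : {fset pdual R H}) (E : {fset orbits phi}).
Hypotheses (Kab : abelian [set: K]%SET) (Sphi : is_transversal_free phi S).
Hypotheses (FS : ([set` F] `<=` S)%classic) (sigmaP : is_section sigma).

(** Passing to coefficients eliminates [FAP]: on [AP F] its choice of preimage is unique, so the
    default value never arises. *)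
Lemma AP_interpolationE Psi f : AP_interpolation sigma E F Psi f <->
  exists2 u, f = @FAP_inv R K H phi F u & ev sigma E F u = sampl sigma E Psi.
Proof.
rewrite /AP_interpolation (AP_FAP_inv _ _ Kab); split=> [[[u ->]]|[u -> uE]].
  by rewrite (FAP_invK Sphi FS); exists u.
by rewrite (FAP_invK Sphi FS); split=> //; exists u.
Qed.

Lemma well_posed_ev_inj : AP_well_posed sigma E F -> injective (ev sigma E F).
Proof.
(* [ev u] is by definition the sampling of [FAP_inv u]; if [ev u = ev v], then [FAP_inv u] and
   [FAP_inv v] interpolate the same function. *)
move=> wp u v uv; have [f [_ fU]] := wp (@FAP_inv R K H phi F u).
apply: (FAP_inv_inj Sphi FS).
by transitivity f; [apply/esym|]; apply: fU; apply/AP_interpolationE;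
  [exists u|exists v].
Qed.

(* Interpolating the functions (k, x) |-> v (orbit of x) and averaging over
   K yields every v : E -> C from the Bessel functions of the trivial character. *)
Lemma well_posed_leq_card : AP_well_posed sigma E F -> (#|{: E}| <= #|{: F}|)%N.
Proof.
move=> wp; apply: (@surjective_form_leq_card R[i] F E
  (fun l y => \sum_r val l (phi r (sigma (val y))))) => v.
(* Orbits are disjoint, so at most one term survives, and none off the orbits in [E]. *)
pose Psi (g : sdgroup phi) : R[i] := \sum_(y : E | `[< val (val y) g.2 >]) v y.
have [_ [/AP_interpolationE[u _ uE] _]] := wp Psi.
exists (fun l => (#|K|%:R)^-1 * \sum_n u (1%g, n, l)) => y.
transitivity ((#|K|%:R)^-1 * \sum_h sampl sigma E Psi (1%g, h, y)).
  under eq_bigr => h _.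
    rewrite ffunE/= /Psi (big_pred1 y); last first.
      move=> z; apply/asboolP/eqP; rewrite (orbits_eqE _ _ (sigmaP _)).
        exact: val_inj.
      by move=> ->.
  over.
  by rewrite sumr_const -[X in _ * X]mulr_natl mulKf// natr_cardG_neq0.
rewrite -uE; under [in RHS]eq_bigr do rewrite -mulrA.
rewrite -mulr_sumr; congr (_ * _).
under eq_bigr do rewrite evE.
rewrite exchange_big/=; apply: eq_bigr => l _.
rewrite exchange_big mulr_suml/=; apply: eq_bigr => n _.
rewrite -mulr_suml mulrC mulg1; congr (_ * _).
(* Summation over all [h] absorbs the shift by [n^-1], leaving an orbit sum independent of [n]. *)
by rewrite [RHS](reindex_inj (mulgI n^-1%g)).
Qed.

Lemma AP_well_posedE : AP_well_posed sigma E F <-> bijective (ev sigma E F).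
Proof.
split=> [wp|[g evK gK] Psi].
  by apply: ev_bijective; [exact: well_posed_ev_inj|exact: well_posed_leq_card].
exists (FAP_inv (g (sampl sigma E Psi))); split.
  by apply/AP_interpolationE; exists (g (sampl sigma E Psi)).
by move=> f /AP_interpolationE[u -> <-]; rewrite evK.
Qed.

End WellPosed.

Theorem theorem3 (R : realType) (K : finGroupType) (H : topologicalZmodType)
  (phi : topaut_action K H) (S : set (pdual R H)) (sigma : orbits phi -> H)
  (F : {fset pdual R H}) (E : {fset orbits phi})
  (K_abelian : abelian [set: K]%SET)
  (H_locally_compact : locally_compact [set: H]%classic)
  (H_hausdorff : hausdorff_space H)
  (S_transversal : is_transversal_free phi S)
  (F_sub_S : ([set` F] `<=` S)%classic)
  (sigma_section : is_section sigma) :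
  ev sigma E F =1
    tens_mid (adjop (@dft R K)) \o @regroup_inv R K (kdual R K) E
      \o fourier_bessel sigma E F
      \o @regroup R K (kdual R K) F \o tens_mid (@dft R K)
  /\ (AP_well_posed sigma E F <-> bijective (fourier_bessel sigma E F)).
Proof.
have evJ := @ev_decomposition R K H phi sigma E F K_abelian.
split=> //; rewrite (AP_well_posedE E K_abelian S_transversal F_sub_S)//.
have dftA : cancel _ (adjop (@dft R K)) := dftK K_abelian.
have Adft : cancel (adjop (@dft R K)) (@dft R K) := @adjop_dftK R K.
have bij_dft (L : finType) : bijective (@tens_mid R K K (kdual R K) L (@dft R K)).
  by exists (tens_mid (adjop (@dft R K))); exact: tens_mid_can.
have bij_adj (L : finType) :
    bijective (@tens_mid R K (kdual R K) K L (adjop (@dft R K))).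
  by exists (tens_mid (@dft R K)); exact: tens_mid_can.
have bij_regroup (L : finType) : bijective (@regroup R K (kdual R K) L).
  by exists (@regroup_inv _ _ _ _); [exact: regroupK|exact: regroup_invK].
have bij_regroup_inv (L : finType) : bijective (@regroup_inv R K (kdual R K) L).
  by exists (@regroup _ _ _ _); [exact: regroup_invK|exact: regroupK].
split=> [bij_ev|bij_J].
  (* The factorization solved for the Fourier-Bessel operator by inverting the outer factors. *)
  have JE : @regroup R K (kdual R K) E \o tens_mid (@dft R K) \o ev sigma E F
      \o tens_mid (adjop (@dft R K)) \o @regroup_inv R K (kdual R K) F
      =1 fourier_bessel sigma E F.
    by move=> w; rewrite /= evJ/= !(tens_mid_can Adft) !regroup_invK.
  apply: eq_bij JE; apply: (bij_comp _ (bij_regroup_inv _)).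
  apply: (bij_comp _ (bij_adj _)); apply: (bij_comp _ bij_ev).
  exact: bij_comp (bij_regroup _) (bij_dft _).
apply: eq_bij (fsym evJ); apply: (bij_comp _ (bij_dft _)).
apply: (bij_comp _ (bij_regroup _)); apply: (bij_comp _ bij_J).
exact: bij_comp (bij_adj _) (bij_regroup_inv _).
Qed.
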